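(* Let $\Phi=(G,\varphi)$ be a $\mathbb{T}$-gain graph on a connected graph $G$. Then $\Phi$ is distance compatible if and only if every block of $\Phi$ (i.e. every block $B$ of $G$ with the restriction of $\varphi$ to the oriented edges of $B$) is distance compatible.
   Context: $\mathbb{T}=\{z\in\mathbb{C}:|z|=1\}$. A $\mathbb{T}$-gain graph $\Phi=(G,\varphi)$ on a simple graph $G$ assigns to each oriented edge $\overrightarrow{e}_{i,j}$ an element $\varphi(\overrightarrow{e}_{i,j})\in\mathbb{T}$ with $\varphi(\overrightarrow{e}_{j,i})=\varphi(\overrightarrow{e}_{i,j})^{-1}$. The gain of an oriented path is the product of the gains of its consecutive oriented edges. $d(s,t)$ is the graph distance. $\mathcal{P}(s,t)$ is the set of oriented shortest paths from $s$ to $t$; $\mathcal{P}^{\max}(s,t)$ (resp. $\mathcal{P}^{\min}(s,t)$) is the set of those whose gain has maximum (resp. minimum) real part in $\mathcal{P}(s,t)$. For a total order $<$ on the vertex set and $s<t$, $\varphi^{<}_{\max}(s,t)$ is the gain of a path in $\mathcal{P}^{\max}(s,t)$ with maximum imaginary part of gain among paths in $\mathcal{P}^{\max}(s,t)$, and $\varphi^{<}_{\max}(t,s)=\overline{\varphi^{<}_{\max}(s,t)}$; $\varphi^{<}_{\min}(s,t)$ is the gain of a path in $\mathcal{P}^{\min}(s,t)$ with minimum imaginary part of gain among paths in $\mathcal{P}^{\min}(s,t)$, and $\varphi^{<}_{\min}(t,s)=\overline{\varphi^{<}_{\min}(s,t)}$. The gain distance matrices are $D^{\max}_{<}=(\varphi^{<}_{\max}(v_i,v_j)d(v_i,v_j))$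 and $D^{\min}_{<}=(\varphi^{<}_{\min}(v_i,v_j)d(v_i,v_j))$. A $\mathbb{T}$-gain graph is distance compatible if $D^{\max}_{<}=D^{\min}_{<}$ for the standard order $v_1<\dots<v_n$ of its vertices (equivalently, for any total order). A block of $G$ is a maximal connected subgraph without a cut vertex. *)

(* Defs.v *)
From HB Require Import structures.
From mathcomp Require Import all_boot all_order all_algebra.
From mathcomp Require Import reals complex.

Set Implicit Arguments.
Unset Strict Implicit.
Unset Printing Implicit Defensive.

Import Order.TTheory GRing.Theory Num.Theory.
Local Open Scope ring_scope.

(* Simple graphs whose vertex set is a subset of a fixed finite type, so that a
   graph and its subgraphs live in the same type. *)
Record sgraph (V : finType) := SGraph {
  verts : {set V};
  adj : rel V;
  adj_sym : symmetric adj;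
  adj_irr : irreflexive adj;
  adj_verts : forall x y, adj x y -> x \in verts }.

Section Graph.
Variable V : finType.
Implicit Types (G H K : sgraph V) (s t v x y : V) (p : seq V).

Definition subgraph H G : Prop :=
  verts H \subset verts G /\ subrel (adj H) (adj G).

Definition gconnected G : Prop :=
  verts G != set0 /\ {in verts G &, forall x y, connect (adj G) x y}.

Definition del_adj G v : rel V :=
  [rel x y | [&& x != v, y != v & adj G x y]].

Lemma del_adj_sym G v : symmetric (del_adj G v).
Proof. by move=> x y; rewrite /del_adj /= adj_sym andbCA. Qed.

Lemma del_adj_irr G v : irreflexive (del_adj G v).
Proof. by move=> x; rewrite /del_adj /= adj_irr !andbF. Qed.

Lemma del_adj_verts G v x y : del_adj G v x y -> x \in verts G :\ v.
Proof.
by case/and3P=> xv _ /adj_verts xG; rewrite in_setD1 xv.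
Qed.

Definition del_vertex G v : sgraph V :=
  SGraph (del_adj_sym G v) (@del_adj_irr G v) (@del_adj_verts G v).

(* v separates two other vertices of its component; in particular the
   one-vertex graph has no cut vertex. *)
Definition cut_vertex G v : Prop :=
  v \in verts G /\
  exists x y, [/\ x \in verts (del_vertex G v), y \in verts (del_vertex G v),
                  connect (adj G) x y & ~~ connect (adj (del_vertex G v)) x y].

Definition nonseparable G : Prop :=
  gconnected G /\ forall v, ~ cut_vertex G v.

(* Maximality is among all subgraphs, not only the induced ones. *)
Definition block B G : Prop :=
  [/\ subgraph B G, nonseparable B &
      forall H, subgraph H G -> nonseparable H -> subgraph B H ->
        subgraph H B].

(* The path s = x_0, x_1, ..., x_k = t is encoded by p = [:: x_1; ...; x_k]. *)
Definition is_path G s t p : bool :=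
  [&& s \in verts G, path (adj G) s p, last s p == t & uniq (s :: p)].

(* Takes the junk value #|V| when t is not reachable from s. *)
Definition dist G s t : nat :=
  find (fun k => [exists p : k.-tuple V, is_path G s t p]) (iota 0 #|V|).

Definition shortest_paths G s t : {set (dist G s t).-tuple V} :=
  [set p : (dist G s t).-tuple V | is_path G s t p].

End Graph.

(* Only the values of gain on adjacent pairs are meaningful. *)
Record gain_graph (R : realType) (V : finType) := GainGraph {
  ggraph :> sgraph V;
  gain : V -> V -> R[i];
  gain_norm : forall x y, adj ggraph x y -> `|gain x y| = 1;
  gain_inv : forall x y, adj ggraph x y -> gain y x = (gain x y)^-1 }.

Lemma subgain_norm (R : realType) (V : finType) (Phi : gain_graph R V)
    (H : sgraph V) (sH : subgraph H Phi) x y :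
  adj H x y -> `|gain Phi x y| = 1.
Proof. by move=> /(proj2 sH)/gain_norm. Qed.

Lemma subgain_inv (R : realType) (V : finType) (Phi : gain_graph R V)
    (H : sgraph V) (sH : subgraph H Phi) x y :
  adj H x y -> gain Phi y x = (gain Phi x y)^-1.
Proof. by move=> /(proj2 sH)/gain_inv. Qed.

Definition subgain (R : realType) (V : finType) (Phi : gain_graph R V)
    (H : sgraph V) (sH : subgraph H Phi) : gain_graph R V :=
  GainGraph (subgain_norm sH) (subgain_inv sH).

Section GainDistance.
Variables (R : realType) (V : finType) (Phi : gain_graph R V).
Implicit Types (s t : V) (p : seq V) (lt : rel V).

Definition path_gain s p : R[i] :=
  \prod_(g <- pairmap (gain Phi) s p) g.

Definition re_gain s p : R := complex.Re (path_gain s p).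
Definition im_gain s p : R := complex.Im (path_gain s p).

Definition Pmax s t : {set (dist Phi s t).-tuple V} :=
  [set p in shortest_paths Phi s t |
    [forall q in shortest_paths Phi s t, re_gain s q <= re_gain s p]].

Definition Pmin s t : {set (dist Phi s t).-tuple V} :=
  [set p in shortest_paths Phi s t |
    [forall q in shortest_paths Phi s t, re_gain s p <= re_gain s q]].

(* The chosen path is not unique, but its gain is. The default 0 is reached
   only when t is not reachable from s. *)
Definition max_gain s t : R[i] :=
  if [pick p in Pmax s t | [forall q in Pmax s t, im_gain s q <= im_gain s p]]
  is Some p then path_gain s p else 0.

Definition min_gain s t : R[i] :=
  if [pick p in Pmin s t | [forall q in Pmin s t, im_gain s p <= im_gain s q]]
  is Some p then path_gain s p else 0.

Definition phi_max lt s t : R[i] :=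
  if lt s t then max_gain s t else Num.conj (max_gain t s).

Definition phi_min lt s t : R[i] :=
  if lt s t then min_gain s t else Num.conj (min_gain t s).

(* Rows and columns are indexed by the vertices of Phi, in enumeration order. *)
Definition Dmax lt : 'M[R[i]]_#|verts Phi| :=
  \matrix_(i, j) (phi_max lt (enum_val i) (enum_val j)
                  * (dist Phi (enum_val i) (enum_val j))%:R).

Definition Dmin lt : 'M[R[i]]_#|verts Phi| :=
  \matrix_(i, j) (phi_min lt (enum_val i) (enum_val j)
                  * (dist Phi (enum_val i) (enum_val j))%:R).

End GainDistance.

Definition std_order (n : nat) : rel 'I_n := fun i j => (i < j)%N.

Definition distance_compatible (R : realType) (n : nat)
    (Phi : gain_graph R 'I_n) : Prop :=
  Dmax Phi (@std_order n) = Dmin Phi (@std_order n).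

(* Main.v *)
(** Distance compatibility says exactly that any two shortest paths with the
    same ends have the same gain.  A block contains every simple path of [G]
    joining two of its vertices, because adding such a path to a nonseparable
    subgraph keeps it nonseparable; so the distances and the shortest paths of a
    block are those of [G], which gives one direction.  For the other, take two
    shortest paths from [s] to [t], by induction on their length.  If they share
    an inner vertex, split both there.  Otherwise the second one followed by the
    reverse of the first one, up to its first inner vertex [x], is a simple path
    from [s] to [x] through [t], so [t] lies in the block of the edge [sx], and
    the block decides. *)

Require Import Defs.
From mathcomp Require Import all_boot all_order all_algebra.
From mathcomp Require Import reals complex boolp.

Set Implicit Arguments.
Unset Strict Implicit.
Unset Printing Implicit Defensive.

Import Order.TTheory GRing.Theory Num.Theory.

(** * Subgraphs and induced subgraphs *)

Section Graphs.
Variable V : finType.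
Implicit Types (G H K B : sgraph V) (S : {set V}) (s t v w x y : V) (p q : seq V).

Lemma subgraph_refl G : subgraph G G.
Proof. by split. Qed.

Lemma subgraph_trans K G H : subgraph G K -> subgraph K H -> subgraph G H.
Proof.
move=> [vGK aGK] [vKH aKH]; split; first exact: subset_trans vKH.
by move=> x y /aGK/aKH.
Qed.

Lemma adj_verts2 G x y : adj G x y -> y \in verts G.
Proof. by rewrite adj_sym => /adj_verts. Qed.

Lemma path_verts G s p :
  s \in verts G -> path (adj G) s p -> {subset s :: p <= verts G}.
Proof.
elim: p s => [|y p IHp] s sG /=; first by move=> _ x /[!inE] /eqP->.
case/andP=> sy /(IHp _ (adj_verts2 sy)) sub x.
by rewrite inE => /predU1P[-> //|]; apply: sub.
Qed.

Section Induced.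
Variables (G : sgraph V) (S : {set V}).

Definition induced_adj : rel V := [rel x y | [&& x \in S, y \in S & adj G x y]].

Lemma induced_adj_sym : symmetric induced_adj.
Proof. by move=> x y; rewrite /induced_adj /= adj_sym andbCA. Qed.

Lemma induced_adj_irr : irreflexive induced_adj.
Proof. by move=> x; rewrite /induced_adj /= adj_irr !andbF. Qed.

Lemma induced_adj_verts x y : induced_adj x y -> x \in S.
Proof. by case/and3P. Qed.

Definition induced : sgraph V :=
  SGraph induced_adj_sym induced_adj_irr induced_adj_verts.

Lemma induced_subgraph : S \subset verts G -> subgraph induced G.
Proof. by move=> SG; split=> // x y /and3P[]. Qed.

Lemma subgraph_induced H : subgraph H G -> verts H \subset S -> subgraph H induced.
Proof.
move=> [_ aHG] HS; split=> // x y xy; rewrite /= /induced_adj /=.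
by rewrite !(subsetP HS) ?aHG // ?(adj_verts xy) ?(adj_verts2 xy).
Qed.

Lemma path_induced s p :
  {subset s :: p <= S} -> path (adj G) s p -> path (adj induced) s p.
Proof.
move=> /allP sub; apply: sub_in_path sub => x y xS yS xy.
by rewrite /= /induced_adj /= xS yS.
Qed.

End Induced.

(** * Vertex deletion and nonseparable subgraphs *)

Lemma path_del_vertex G v s p :
  v \notin s :: p -> path (adj G) s p -> path (adj (del_vertex G v)) s p.
Proof.
move=> vp; apply: (@sub_in_path _ (predC1 v)).
  by move=> x y xv yv xy; rewrite /= /del_adj /= xy andbT; apply/andP.
by apply/allP => x xp /=; apply: contraNneq vp => <-.
Qed.

(** The vertex [v] may lie outside [G], and then its deletion removes no edge. This case occurs when
    [v] lies on a path added to [G] but not in [G] itself. *)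
Lemma nonseparable_connect G v x y :
    nonseparable G -> x \in verts G -> y \in verts G -> x != v -> y != v ->
  connect (adj (del_vertex G v)) x y.
Proof.
move=> [[_ conG] noncut] xG yG xv yv.
have [vG|vG] := boolP (v \in verts G).
  apply/negPn/negP => nxy; apply: (noncut v); split=> //.
  by exists x, y; split=> //; rewrite ?in_setD1 ?xv ?yv //; apply: conG.
apply: connect_sub (conG _ _ xG yG) => a b ab; apply: connect1.
rewrite /= /del_adj /= ab andbT; apply/andP.
by split; apply: contraNneq vG => <-; [apply: adj_verts ab|apply: adj_verts2 ab].
Qed.

Lemma connect_del_vertexS H G v :
  subgraph H G ->
  subrel (connect (adj (del_vertex H v))) (connect (adj (del_vertex G v))).
Proof.
move=> [_ aHG]; apply: connect_sub => a b /and3P[av bv ab].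
by apply: connect1; rewrite /= /del_adj /= av bv aHG.
Qed.

Lemma edge_nonseparable G x y : adj G x y -> nonseparable (induced G [set x; y]).
Proof.
move=> xy; split.
  split; first by apply/set0Pn; exists x; rewrite /= !inE eqxx.
  have xy' : adj (induced G [set x; y]) x y by rewrite /= /induced_adj /= !inE !eqxx orbT.
  by move=> a b /set2P[]-> /set2P[]->; rewrite ?connect0 // connect1 // adj_sym.
move=> v [/= /set2P vxy [a [b [/setD1P[av /set2P axy] /setD1P[bv /set2P bxy] _]]]].
suff -> : a = b by rewrite connect0.
by case: vxy axy bxy av bv => -> [] -> [] ->; rewrite ?eqxx.
Qed.

(** After the deletion of a vertex, each remaining vertex of the path still reaches [H] along the
    path, and what remains of [H] is connected. Edges that the induced subgraph has beyond those of
    [H] and the path do no harm to connectivity. *)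
Lemma nonseparable_add_path G H x y p :
    subgraph H G -> nonseparable H -> x \in verts H -> y \in verts H ->
    is_path G x y p ->
  nonseparable (induced G (verts H :|: [set z in x :: p])).
Proof.
move=> sHG nsH xH yH /and4P[xG xp /eqP lastp up].
set S := _ :|: _; set K := induced G S.
have sHK : subgraph H K by apply: subgraph_induced; rewrite ?subsetUl.
have pS : {subset x :: p <= S} by move=> z zp; rewrite in_setU inE zp orbT.
have xpK : path (adj K) x p by apply: path_induced.
split.
  split; first by apply/set0Pn; exists x; rewrite /= in_setU xH.
  suff toK a : a \in verts K -> connect (adj K) x a.
    move=> a b /toK xa /toK xb; apply: connect_trans xb.
    by rewrite (sym_connect_sym (@adj_sym _ K)).
  rewrite /= in_setU inE => /orP[aH|ap]; last exact: path_connect xpK _ ap.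
  have [[_ conH] _] := nsH; apply: connect_sub (conH _ _ xH aH).
  by move=> b c bc; apply: connect1; apply: (proj2 sHK).
move=> v [_ [a [b [/setD1P[av aK] /setD1P[bv bK] _]]]].
set D := del_vertex K v; have symD := sym_connect_sym (@adj_sym _ D).
(* As [v] occurs at most once on the path, one of the two halves cut at [c] avoids it. *)
have toH c : c != v -> c \in verts K ->
    exists h, [/\ h \in verts H, h != v & connect (adj D) c h].
  move=> cv; rewrite /= in_setU inE => /orP[cH|]; first by exists c; rewrite connect0.
  move=> cp; move: xpK up lastp; case/splitPl: cp => p1 p2 lastp1.
  rewrite cat_path last_cat lastp1 => /andP[xp1 cp2] up lastp2.
  have [vp1|vp1] := boolP (v \in x :: p1).
    have vp2 : v \notin c :: p2.
      rewrite inE negb_or eq_sym cv /=; move: up; rewrite -cat_cons cat_uniq.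
      by case/and3P=> _ /hasPn p12 _; apply: contraL vp1 => /p12.
    exists y; split=> //.
      by apply: contraNneq vp2 => <-; rewrite -lastp2 mem_last.
    by rewrite -lastp2; apply/connectP; exists p2 => //; apply: path_del_vertex.
  exists x; split=> //; first by apply: contraNneq vp1 => <-; rewrite mem_head.
  by rewrite symD -lastp1; apply/connectP; exists p1 => //; apply: path_del_vertex.
have [ha [haH hav aha]] := toH a av aK.
have [hb [hbH hbv bhb]] := toH b bv bK.
apply/negP/negPn; apply: connect_trans aha _; rewrite symD.
apply: connect_trans bhb _.
by apply: (connect_del_vertexS sHK); apply: nonseparable_connect.
Qed.

(** * Blocks *)

Definition graph_size G := (#|verts G| + #|[set e : V * V | adj G e.1 e.2]|)%N.

(** Edges have to be counted along with vertices, because a proper subgraph can have all the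
    vertices. *)
Lemma ltn_graph_size G H :
  subgraph G H -> ~ subgraph H G -> (graph_size G < graph_size H)%N.
Proof.
move=> [vGH aGH] nHG.
have aGH' : [set e : V * V | adj G e.1 e.2] \subset [set e | adj H e.1 e.2].
  by apply/subsetP => e; rewrite !inE; apply: aGH.
rewrite ltn_neqAle leq_add ?subset_leq_card // andbT; apply/negP => /eqP eqGH.
(* If the two sums agree, so do their summands, and both inclusions are equalities. *)
have [lev lea] := (subset_leq_card vGH, subset_leq_card aGH').
apply: nHG; split.
  suff /eqP-> : verts G == verts H by [].
  by rewrite eqEcard vGH /= -(leq_add2r #|[set e | adj G e.1 e.2]|) -/(graph_size G)
             eqGH leq_add2l.
have eqa : [set e : V * V | adj G e.1 e.2] = [set e | adj H e.1 e.2].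
  apply/eqP; rewrite eqEcard aGH' /= -(leq_add2l #|verts G|) -/(graph_size G).
  by rewrite eqGH leq_add2r.
by move=> x y xy; have := in_set (fun e => adj H e.1 e.2) (x, y); rewrite -eqa inE /= xy.
Qed.

(** As long as [H] is not maximal, it is replaced by a strictly larger nonseparable subgraph; the
    sizes are bounded by that of [G]. *)
Lemma block_exists G H :
  subgraph H G -> nonseparable H -> exists2 B, block B G & subgraph H B.
Proof.
have [m lem] := ubnP (graph_size G - graph_size H).
elim: m H lem => // m IHm H lem sHG nsH.
have [|nmax] := pselect (forall K, subgraph K G -> nonseparable K ->
                           subgraph H K -> subgraph K H).
  by exists H; [split|apply: subgraph_refl].
have [K [sKG nsK sHK nKH]] : exists K, [/\ subgraph K G, nonseparable K,
    subgraph H K & ~ subgraph K H].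
  apply: contrapT => nK; apply: nmax => K sKG nsK sHK.
  by apply: contrapT => nKH; apply: nK; exists K.
have ltHK := ltn_graph_size sHK nKH.
have [|B blB sKB] := IHm K _ sKG nsK; last by exists B => //; apply: subgraph_trans sKB.
have leKG : (graph_size K <= graph_size G)%N.
  apply: leq_add; first exact: subset_leq_card (proj1 sKG).
  by apply/subset_leq_card/subsetP => e; rewrite !inE; apply: (proj2 sKG).
rewrite -ltnS; apply: leq_trans lem; rewrite ltnS.
exact: ltn_sub2l (leq_trans ltHK leKG) ltHK.
Qed.

(** From [G] to [B]: the subgraph induced on [B] and the path is nonseparable, so maximality puts
    it, and with it the path, inside [B]. *)
Lemma is_path_block B G s t p :
    block B G -> s \in verts B -> t \in verts B ->
  is_path B s t p = is_path G s t p.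
Proof.
move=> [sBG nsB maxB] sB tB; apply/idP/idP => stp; have /and4P[sX sp lp up] := stp.
  by apply/and4P; split=> //; [apply: (subsetP (proj1 sBG))|apply: sub_path sp; apply: (proj2 sBG)].
set S := verts B :|: [set z in s :: p].
have SG : S \subset verts G.
  apply/subsetP => z; rewrite in_setU inE => /orP[/(subsetP (proj1 sBG)) //|].
  exact: path_verts.
have [vKB aKB] : subgraph (induced G S) B.
  apply: maxB; first exact: induced_subgraph.
    exact: nonseparable_add_path stp.
  by apply: subgraph_induced; rewrite ?subsetUl.
apply/and4P; split=> //; apply: sub_path aKB _ _ _; apply: path_induced sp => z zp.
by rewrite in_setU [_ \in [set _ in _]]inE zp orbT.
Qed.

Lemma dist_block B G s t :
  block B G -> s \in verts B -> t \in verts B -> dist B s t = dist G s t.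
Proof.
move=> blB sB tB; apply: eq_find => k; apply: eq_existsb => p.
exact: is_path_block.
Qed.

(** * Distances and geodesics *)

Lemma dist_le G s t p :
  s \in verts G -> path (adj G) s p -> last s p = t -> (dist G s t <= size p)%N.
Proof.
move=> sG; case/shortenP=> q sq uq subq lq.
have leqp : (size q <= size p)%N by apply: uniq_leq_size subq; case/andP: uq.
apply: leq_trans leqp; rewrite leqNgt; apply/negP => ltq.
have := before_find 0 ltq; rewrite nth_iota ?add0n => [/existsP[]|].
  by exists (in_tuple q); apply/and4P; split=> //=; apply/eqP.
(* A path without repeated vertices has fewer than [#|V|] edges, so its length is among the values
   searched by [dist]. *)
by rewrite (leq_trans _ (max_card (mem (s :: q)))) // (card_uniqP uq).
Qed.

(** Reachability makes the search in [dist] succeed below [#|V|], so its value is not the junk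
    one. *)
Lemma dist_attained G s t p :
  s \in verts G -> path (adj G) s p -> last s p = t ->
  exists q : (dist G s t).-tuple V, is_path G s t q.
Proof.
move=> sG; case/shortenP=> q sq uq _ lq.
have ltq : (size q < #|V|)%N.
  by rewrite (leq_trans _ (max_card (mem (s :: q)))) // (card_uniqP uq).
have hasd : has (fun k => [exists p : k.-tuple V, is_path G s t p]) (iota 0 #|V|).
  apply/hasP; exists (size q); first by rewrite mem_iota.
  by apply/existsP; exists (in_tuple q); apply/and4P; split=> //=; apply/eqP.
have := nth_find 0 hasd; rewrite nth_iota ?add0n; first by move/existsP.
by rewrite -[X in (_ < X)%N](size_iota 0) -has_find.
Qed.

(** Minimality is among all walks, with no uniqueness of vertices required, so that walks can be
    cut, glued and reversed freely. *)
Definition geodesic G s t p : Prop :=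
  [/\ s \in verts G, path (adj G) s p, last s p = t &
      forall q, path (adj G) s q -> last s q = t -> (size p <= size q)%N].

Lemma geodesicP G s t p :
  geodesic G s t p <-> is_path G s t p /\ size p = dist G s t.
Proof.
split=> [[sG sp lp minp]|[/and4P[sG sp /eqP lp _] szp]]; last first.
  by split=> // q sq lq; rewrite szp dist_le.
split.
  apply/and4P; split=> //; first exact/eqP.
  (* Removing the repetitions gives a walk [q] that is no longer than [p]; by minimality it is no
     shorter either, so [p] had no repetition. *)
  move: lp minp; case/shortenP: (sp) => q sq uq subq lq minp.
  apply: leq_size_uniq uq _ _.
    by move=> z; rewrite !inE => /predU1P[->|/subq->]; rewrite ?eqxx ?orbT.
  by rewrite /= ltnS minp.
apply/eqP; rewrite eqn_leq dist_le // andbT.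
have [q /and4P[_ sq /eqP lq _]] := dist_attained sG sp lp.
by rewrite -(size_tuple q) minp.
Qed.

Lemma geodesic_uniq G s t p : geodesic G s t p -> uniq (s :: p).
Proof. by case/geodesicP=> /and4P[]. Qed.

Lemma geodesic_size G s t p q :
  geodesic G s t p -> geodesic G s t q -> size p = size q.
Proof. by move=> /geodesicP[_ ->] /geodesicP[_ ->]. Qed.

Lemma geodesic_block B G s t p :
    block B G -> s \in verts B -> t \in verts B ->
  geodesic B s t p <-> geodesic G s t p.
Proof.
move=> blB sB tB; split=> /geodesicP[stp szp]; apply/geodesicP.
  by rewrite -(is_path_block _ blB) // -(dist_block blB).
by rewrite (is_path_block _ blB) // (dist_block blB).
Qed.

Lemma geodesic_cat G s t p q :
    geodesic G s t (p ++ q) ->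
  geodesic G s (last s p) p /\ geodesic G (last s p) t q.
Proof.
move=> [sG]; rewrite cat_path last_cat => /andP[sp pq] lpq minpq.
split; split=> //.
- move=> r sr lr; rewrite -(leq_add2r (size q)) -!size_cat minpq //.
    by rewrite cat_path sr lr.
  by rewrite last_cat lr.
- by apply: path_verts sG sp _ _; rewrite mem_last.
- move=> r lr lrt; rewrite -(leq_add2l (size p)) -!size_cat minpq //.
    by rewrite cat_path sp.
  by rewrite last_cat.
Qed.

(** The code of a path omits its first vertex, so the reverse path omits [last s p] and is coded by
    [rev (belast s p)]. *)
Lemma rev_walk G s p :
  path (adj G) s p -> path (adj G) (last s p) (rev (belast s p)).
Proof. by rewrite rev_path; apply: sub_path => x y; rewrite adj_sym. Qed.

Lemma last_rev_belast s p : last (last s p) (rev (belast s p)) = s.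
Proof. by case: p => //= x p; rewrite rev_cons last_rcons. Qed.

Lemma geodesic_rev G s t p :
  geodesic G s t p -> geodesic G t s (rev (belast s p)).
Proof.
move=> [sG sp <- minp]; split=> [||//|q tq lq].
- by apply: path_verts sG sp _ _; rewrite mem_last.
- exact: rev_walk.
- exact: last_rev_belast.
rewrite size_rev size_belast -(size_belast (last s p) q) -[X in (_ <= X)%N]size_rev minp //.
  by rewrite -{1}lq rev_walk.
by rewrite -{1}lq last_rev_belast.
Qed.

End Graphs.

Local Open Scope ring_scope.

(** * Gains of geodesics *)

Section Gains.
Variables (R : realType) (V : finType) (Phi : gain_graph R V).
Implicit Types (s t : V) (p q : seq V).

(** This form of distance compatibility involves neither an order on the vertices nor a choice of
    path. *)
Definition geodesic_gain_unique : Prop := forall s t p q,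
  geodesic Phi s t p -> geodesic Phi s t q ->
  path_gain Phi s p = path_gain Phi s q.

Lemma path_gain_cat s p q :
  path_gain Phi s (p ++ q) = path_gain Phi s p * path_gain Phi (last s p) q.
Proof. by rewrite /path_gain pairmap_cat big_cat. Qed.

Lemma path_gain_cons s x p :
  path_gain Phi s (x :: p) = gain Phi s x * path_gain Phi x p.
Proof. by rewrite /path_gain /= big_cons. Qed.

Lemma path_gain_rev s p :
  path (adj Phi) s p ->
  path_gain Phi (last s p) (rev (belast s p)) = (path_gain Phi s p)^-1.
Proof.
elim: p s => [|x p IHp] s /=; first by rewrite /path_gain !big_nil invr1.
case/andP=> sx xp; rewrite rev_cons -cats1 path_gain_cat IHp // last_rev_belast.
by rewrite !path_gain_cons /path_gain big_nil mulr1 (gain_inv sx) invfM mulrC.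
Qed.

Lemma mem_shortest_paths s t (p : (dist Phi s t).-tuple V) :
  p \in shortest_paths Phi s t <-> geodesic Phi s t p.
Proof.
rewrite inE; split; first by move=> stp; apply/geodesicP; rewrite size_tuple.
by case/geodesicP.
Qed.

(** When all gains agree, [Pmax] and [Pmin] both consist of all shortest paths, and every one of
    these passes both tests. So the two picks fail only together, with common default 0. *)
Lemma max_min_gain_eq s t :
    geodesic_gain_unique -> max_gain Phi s t = min_gain Phi s t.
Proof.
move=> uniqPhi.
have sh_eq (p q : (dist Phi s t).-tuple V) : p \in shortest_paths Phi s t ->
    q \in shortest_paths Phi s t -> path_gain Phi s p = path_gain Phi s q.
  by move=> /mem_shortest_paths gp /mem_shortest_paths; apply: uniqPhi gp.
have PmaxE : Pmax Phi s t = shortest_paths Phi s t.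
  apply/setP => p; rewrite [LHS]inE; have [sp|//] := boolP (p \in _).
  by apply/forall_inP => q sq; rewrite /re_gain (sh_eq q p).
have PminE : Pmin Phi s t = shortest_paths Phi s t.
  apply/setP => p; rewrite [LHS]inE; have [sp|//] := boolP (p \in _).
  by apply/forall_inP => q sq; rewrite /re_gain (sh_eq q p).
rewrite /max_gain /min_gain PmaxE PminE.
case: pickP => [p /andP[sp _]|none]; case: pickP => [q /andP[sq _]|none'] //.
- exact: sh_eq.
- have := none' p; rewrite sp /= => /negP[]; apply/forall_inP => q sq.
  by rewrite /im_gain (sh_eq q p).
- have := none q; rewrite sq /= => /negP[]; apply/forall_inP => p sp.
  by rewrite /im_gain (sh_eq q p).
Qed.

Lemma geodesic_shortest s t p :
  geodesic Phi s t p ->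
  exists2 p' : (dist Phi s t).-tuple V, p' \in shortest_paths Phi s t & p = p'.
Proof.
move=> gp; have [_ szp] := (geodesicP _ _ _ _).1 gp; move/eqP: szp => szp.
by exists (Tuple szp) => //; apply/mem_shortest_paths.
Qed.

(** [max_gain] is the lexicographic maximum of the pairs of real and imaginary parts. *)
Lemma max_gain_ge s t p :
    geodesic Phi s t p ->
  complex.Re (path_gain Phi s p) <= complex.Re (max_gain Phi s t) /\
  (complex.Re (path_gain Phi s p) = complex.Re (max_gain Phi s t) ->
   complex.Im (path_gain Phi s p) <= complex.Im (max_gain Phi s t)).
Proof.
case/geodesic_shortest=> {}p sp ->; rewrite /max_gain.
case: pickP => [p0 /andP[Pp0 /forall_inP imp0]|none].
  have /setIdP[_ /forall_inP rep0] := Pp0; split=> [|eqre]; first exact: rep0.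
  apply: imp0; apply/setIdP; split=> //; apply/forall_inP => q /rep0.
  by rewrite /re_gain eqre.
(* The pick cannot fail: maximize the real part over the shortest paths, then the imaginary part
   over [Pmax]. *)
have [p1 Pp1] : exists p1 : (dist Phi s t).-tuple V, p1 \in Pmax Phi s t.
  have [p1 sp1 maxp1] := arg_maxP (fun p : (dist Phi s t).-tuple V => re_gain Phi s p) sp.
  by exists p1; apply/setIdP; split=> //; apply/forall_inP.
have [p0 Pp0 maxp0] := arg_maxP (fun p : (dist Phi s t).-tuple V => im_gain Phi s p) Pp1.
by have /negP[] := negbT (none p0); apply/andP; split=> //; apply/forall_inP.
Qed.

Lemma min_gain_le s t p :
    geodesic Phi s t p ->
  complex.Re (min_gain Phi s t) <= complex.Re (path_gain Phi s p) /\
  (complex.Re (path_gain Phi s p) = complex.Re (min_gain Phi s t) ->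
   complex.Im (min_gain Phi s t) <= complex.Im (path_gain Phi s p)).
Proof.
case/geodesic_shortest=> {}p sp ->; rewrite /min_gain.
case: pickP => [p0 /andP[Pp0 /forall_inP imp0]|none].
  have /setIdP[_ /forall_inP rep0] := Pp0; split=> [|eqre]; first exact: rep0.
  apply: imp0; apply/setIdP; split=> //; apply/forall_inP => q /rep0.
  by rewrite /re_gain eqre.
have [p1 Pp1] : exists p1 : (dist Phi s t).-tuple V, p1 \in Pmin Phi s t.
  have [p1 sp1 minp1] := arg_minP (fun p : (dist Phi s t).-tuple V => re_gain Phi s p) sp.
  by exists p1; apply/setIdP; split=> //; apply/forall_inP.
have [p0 Pp0 minp0] := arg_minP (fun p : (dist Phi s t).-tuple V => im_gain Phi s p) Pp1.
by have /negP[] := negbT (none p0); apply/andP; split=> //; apply/forall_inP.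
Qed.

(** Each gain lies lexicographically between the minimum and the maximum, which coincide. *)
Lemma path_gain_max_gain s t p :
    max_gain Phi s t = min_gain Phi s t -> geodesic Phi s t p ->
  path_gain Phi s p = max_gain Phi s t.
Proof.
move=> eqmm gp; have [leRe leIm] := max_gain_ge gp.
have [] := min_gain_le gp; rewrite -eqmm => geRe geIm.
have eqRe : complex.Re (path_gain Phi s p) = complex.Re (max_gain Phi s t).
  by apply/eqP; rewrite eq_le leRe.
by apply/eqP; rewrite eq_complex eqRe eqxx /= eq_le leIm // geIm.
Qed.

End Gains.

(** * Distance compatibility and its reduction to blocks *)

Lemma distance_compatibleP (R : realType) (n : nat) (Phi : gain_graph R 'I_n) :
  distance_compatible Phi <-> geodesic_gain_unique Phi.
Proof.
split=> [dc|uPhi]; last first.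
  by apply/matrixP => i j; rewrite !mxE /phi_max /phi_min !max_min_gain_eq.
have lt_uniq (s t : 'I_n) p q : (s < t)%N -> geodesic Phi s t p -> geodesic Phi s t q ->
    path_gain Phi s p = path_gain Phi s q.
  move=> lt_st gp gq.
  have [sPhi sp lp _] := gp.
  have tPhi : t \in verts Phi by rewrite -lp (path_verts sPhi sp) // mem_last.
  have /matrixP/(_ (enum_rank_in sPhi s) (enum_rank_in tPhi t)) := dc.
  rewrite !mxE !enum_rankK_in // /phi_max /phi_min /std_order lt_st => eqD.
  suff eqmm : max_gain Phi s t = min_gain Phi s t.
    by rewrite (path_gain_max_gain eqmm gp) (path_gain_max_gain eqmm gq).
  (* The factor [dist Phi s t] can be cancelled: it is nonzero because [s] and [t] differ. *)
  apply: mulIf eqD; rewrite pnatr_eq0 -((geodesicP _ _ _ _).1 gp).2 size_eq0.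
  by apply: contraTneq lt_st => p0; rewrite -lp p0 ltnn.
move=> s t p q gp gq; have [lt_st|lt_ts|eq_st] := ltngtP s t.
- exact: lt_uniq gp gq.
(* Reversing both geodesics inverts their gains and exchanges the ends. *)
- apply: invr_inj; have [[_ sp lp _] [_ sq lq _]] := (gp, gq).
  rewrite -(path_gain_rev sp) -(path_gain_rev sq) lp lq.
  by apply: lt_uniq lt_ts _ _; apply: geodesic_rev.
have nil_p r : geodesic Phi s t r -> r = [::].
  by move=> [_ _ _ /(_ [::])]; rewrite leqn0 => minr; apply/nilP/minr => //; apply: val_inj.
by rewrite (nil_p _ gp) (nil_p _ gq).
Qed.

Theorem theorem6p2 (R : realType) (n : nat) (Phi : gain_graph R 'I_n)
    (conn : gconnected Phi) :
  distance_compatible Phi <->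
  (forall (B : sgraph 'I_n) (sB : subgraph B Phi),
     block B Phi -> distance_compatible (subgain sB)).
Proof.
split=> [/distance_compatibleP uPhi B sB blB|dcB]; apply/distance_compatibleP.
  move=> s t p q gp gq; have [sinB sp lp _] := gp.
  have tinB : t \in verts B by rewrite -lp (path_verts sinB sp) // mem_last.
  by apply: (uPhi s t); apply/(geodesic_block _ blB).
move=> s t p; have [m lem] := ubnP (size p).
elim: m s t p lem => // m IHm s t [|x p] lem q gp gq.
  by have := geodesic_size gp gq; case: q {gq}.
have [sPhi /andP[sx xp] lp _] := gp; have [_ sq lq _] := gq.
have szpq := geodesic_size gp gq.
(* [belast x p] lists the inner vertices of the first geodesic. The case without a common one
   includes a single edge, where this list is empty and [x] is [t]. *)
have [xt|nxt] := boolP (has (mem q) (belast x p)); last first.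
  have xPhi := adj_verts2 sx.
  have [|//|B blB sKB] := @block_exists _ Phi (induced Phi [set s; x]).
  - by apply: induced_subgraph; apply/subsetP => z /set2P[]->.
  - exact: edge_nonseparable.
  have [sinB xinB] : s \in verts B /\ x \in verts B.
    by split; apply: (subsetP (proj1 sKB)); rewrite !inE eqxx ?orbT.
  have round : is_path Phi s x (q ++ rev (belast x p)).
    have lxp : last x p = t by [].
    apply/and4P; split=> //.
    - by rewrite cat_path sq lq -lxp rev_walk.
    - by rewrite last_cat lq -lxp last_rev_belast.
    rewrite -cat_cons cat_uniq (geodesic_uniq gq) rev_uniq /= has_rev.
    have := geodesic_uniq gp; rewrite lastI rcons_uniq => /andP[_] /= /andP[sNp ->].
    rewrite andbT; apply/hasPn => z zp /=; rewrite inE negb_or.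
    rewrite (contraNneq _ sNp) => [|<- //].
    by apply: contra nxt => zq; apply/hasP; exists z.
  (* Both ends of the round path lie in [B], hence so does the whole path, in particular its initial
     part [q], which ends in [t]. *)
  move: round; rewrite -(is_path_block _ blB) // => /and4P[_ + _ _].
  rewrite cat_path => /andP[sqB _].
  have tinB : t \in verts B by rewrite -lq (path_verts sinB sqB) // mem_last.
  have [sB _ _] := blB.
  have /distance_compatibleP uB := dcB B sB blB.
  by apply: (uB s t); apply/(geodesic_block _ blB).
have [w wp wq] := hasP xt.
have [ws wt] : w != s /\ w != t.
  have /andP[sp up] : (s \notin x :: p) && uniq (x :: p) := geodesic_uniq gp.
  split; first by apply: contraTneq (mem_belast wp) => ->.
  apply: contraTneq wp => ->; move: up.
  by rewrite lastI rcons_uniq (_ : last x p = t) // => /andP[].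
have {wp} : w \in s :: x :: p by rewrite inE (mem_belast wp) orbT.
have {wq} : w \in s :: q by rewrite inE; apply/orP; right.
move: (x :: p) lem gp gq {szpq lp xp xt sq lq} => {}p lem gp gq wq wp.
case/splitPl: wq gq => q1 q2 lq1 gq; case/splitPl: wp lem gp => p1 p2 lp1 lem gp.
have [gp1 gp2] := geodesic_cat gp; have [gq1 gq2] := geodesic_cat gq.
move: gp1 gp2 gq1 gq2; rewrite !path_gain_cat lp1 lq1 => gp1 gp2 gq1 gq2.
(* The induction applies to either half because the other one is nonempty, [w] being neither [s] nor
   [t]. *)
have p1_gt0 : (0 < size p1)%N.
  by case: p1 lp1 {lem gp gp1} ws => //= <-; rewrite eqxx.
have p2_gt0 : (0 < size p2)%N.
  by case: p2 gp2 {lem gp} wt => // -[_ _ <-]; rewrite eqxx.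
rewrite size_cat ltnS in lem; congr (_ * _).
  by apply: (IHm s w) => //; apply: leq_trans lem; rewrite -addn1 leq_add2l.
by apply: (IHm w t) => //; apply: leq_trans lem; rewrite -add1n leq_add2r.
Qed.
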